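(* Let $n$ and $N$ be positive integers, let $\mathbb{F}\subset\mathbb{C}$ be a field, and let $p_1,\dots,p_n,q_1,\dots,q_n$ be positive integers such that (i) $p_1<\dots<p_n$; (ii) $p_i+q_i=N$ for all $i=1,\dots,n$; (iii) $p_i\neq q_j$ for all $i,j\in\{1,\dots,n\}$ with $i\neq j$. Let $f_1,\dots,f_n,g_1,\dots,g_n\colon\mathbb{F}\to\mathbb{C}$ be additive functions, none of them identically zero, each of which is a higher order derivation in the wide sense (a linear term is allowed; see the context), and suppose that \[ \sum_{i=1}^{n} f_i(x^{p_i})\,g_i(x)^{q_i}=0\qquad\text{for every }x\in\mathbb{F}. \] Let $K$ be the maximum of the orders of the functions $f_1,\dots,f_n,g_1,\dots,g_n$. Then one of the following two alternatives holds. (A) There exist $i\in\{1,\dots,n\}$ and $c_i\in\mathbb{C}$ such that $g_i(x)=c_i\cdot x$ for all $x\in\mathbb{F}$ and $f_i$ contains, as a summand, a derivation of order $K$ (i.e. $f_i$ has order $K$). (B) For all $i\in\{1,\dots,n\}$ the functions $f_i$ and $g_i$ are of order at most $1$, and there are $i_1,i_2\in\{1,\dots,n\}$, $i_1\neq i_2$, such that $q_{i_2}=q_{i_1}+1$ (so $p_{i_2}=p_{i_1}-1$) and, with a derivation $d\colon\mathbb{F}\to\mathbb{C}$, \[ f_{i_1}(x)=\lambda_{i_1,1}d(x)+\lambda_{i_1,0}x,\qquad g_{i_1}(x)=\widetilde\lambda_{i_1,1}d(x)+\widetilde\lambda_{i_1,0}x, \] \[ f_{i_2}(x)=\lambda_{i_2,0}x,\qquad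 g_{i_2}(x)=\widetilde\lambda_{i_2,1}d(x)+\widetilde\lambda_{i_2,0}x \] for all $x\in\mathbb{F}$, where the coefficients are complex numbers, $\lambda_{i_1,1},\widetilde\lambda_{i_1,1},\lambda_{i_2,0},\widetilde\lambda_{i_2,1}$ are nonzero, and \[ p_{i_1}\,\lambda_{i_1,1}\,(\widetilde\lambda_{i_1,1})^{q_{i_1}}+\lambda_{i_2,0}\,(\widetilde\lambda_{i_2,1})^{q_{i_1}+1}=0 . \]
   Context: A function $f\colon\mathbb{F}\to\mathbb{C}$ is additive if $f(x+y)=f(x)+f(y)$ for all $x,y$. An additive $d\colon\mathbb{F}\to\mathbb{C}$ is a derivation if $d(xy)=d(x)y+xd(y)$ for all $x,y\in\mathbb{F}$. Let $\mathscr{D}_0(\mathbb{F})=\{0\}$; for $k\ge1$, $\mathscr{D}_k(\mathbb{F})$ is the set of additive functions $f\colon\mathbb{F}\to\mathbb{C}$ for which there is $B\colon\mathbb{F}\times\mathbb{F}\to\mathbb{C}$ that belongs to $\mathscr{D}_{k-1}(\mathbb{F})$ in each variable and satisfies $f(xy)-xf(y)-f(x)y=B(x,y)$ for all $x,y\in\mathbb{F}$. In this statement, ''higher order derivation in the wide sense'' means a function of the form $x\mapsto D(x)+\lambda x$ with $D\in\mathscr{D}_k(\mathbb{F})$ for some $k\geq 0$ and $\lambda\in\mathbb{C}$ (equivalently, an additive function $f$ such that $x\mapsto f(x)/x$ is a generalized polynomial on the multiplicative group $\mathbb{F}^\times$). Its order is the smallest $k\ge 0$ such that it can be written as $D+\lambda\,\mathrm{id}$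 with $D\in\mathscr{D}_k(\mathbb{F})$, $\lambda\in\mathbb{C}$; thus the functions $x\mapsto\lambda x$ have order $0$. *)

(* Defs.v *)
From HB Require Import structures.
From mathcomp Require Import all_boot all_order all_algebra.
From mathcomp Require Import boolp classical_sets reals.
From mathcomp Require Import complex.

Set Implicit Arguments.
Unset Strict Implicit.
Unset Printing Implicit Defensive.

Import GRing.Theory.

Local Open Scope ring_scope.
Local Open Scope complex_scope.

(* R[i] is the field of complex numbers. A subfield of it is given by a subset
   A together with its subtype F : subFieldType A; the inclusion
   \val : F -> R[i] is then a ring morphism with image A. *)
Section HigherOrderDerivations.

Variables (R : realType) (A : pred R[i]) (F : subFieldType A).

Implicit Types (f d : F -> R[i]).

Definition additive_fun f : Prop := forall x y, f (x + y) = f x + f y.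

Definition derivation d : Prop :=
  additive_fun d /\ forall x y, d (x * y) = d x * \val y + \val x * d y.

(* hder k is the class D_k, and wide_hder k is D_k + C id. *)
Fixpoint hder (k : nat) f : Prop :=
  match k with
  | 0 => forall x, f x = 0
  | k'.+1 =>
      additive_fun f /\
      exists B : F -> F -> R[i],
        [/\ forall y, hder k' (fun x => B x y),
            forall x, hder k' (fun y => B x y) &
            forall x y, f (x * y) - \val x * f y - f x * \val y = B x y]
  end.

Definition wide_hder (k : nat) f : Prop :=
  exists (D : F -> R[i]) (lambda : R[i]),
    hder k D /\ forall x, f x = D x + lambda * \val x.

Definition is_wide_hder f : Prop := exists k, wide_hder k f.

(* The order is meaningful only when [is_wide_hder f]; it is 0 otherwise. *)
Definition wide_order f : nat :=
  xget 0%N [set k | wide_hder k f /\ forall j, wide_hder j f -> (k <= j)%N].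

End HigherOrderDerivations.

(* Main.v *)
Require Import Defs.
From mathcomp Require Import all_boot all_order all_algebra.
From mathcomp Require Import boolp classical_sets reals.
From mathcomp Require Import complex zify ring.

(* The functions in wide_hder k are the differential operators of order at most
   k: with (ad y f)(x) = f(xy) - y f(x), their (k + 1)-fold ad y vanishes, and a
   function of order exactly k has (ad y)^k f(1) <> 0 for some y; one y serves
   all the f_i and g_i at once. Since f(P(y)) is the sum over j of
   (ad y)^j f(1) times the coefficient of T^j in P(y + T), inserting x = P(y)
   for integer P and using Zariski density yields
     sum_i F_i(h^p_i) G_i(h)^q_i = 0   for all complex polynomials h(T),
   where F_i and G_i are linear forms in the coefficients of h up to the order
   of f_i and g_i. For h = u + s T^K with u(0) = 1, F_i(h^p_i) and G_i(h) are
   affine in s, so comparing powers of s is elementary. If (A) fails, the largest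
   q_a with g_a of order K has q_a > 1; its top power of s can only be cancelled
   by an index b with q_a = q_b + 1 and f_b, g_b of order K, and forces f_a to
   have order 0; the next power of s forces K = 1. The top equation, valid for
   every y, then says that the derivations occurring in f_b, g_b and g_a are
   proportional. *)

Set Implicit Arguments.
Unset Strict Implicit.
Unset Printing Implicit Defensive.

Import Order.TTheory GRing.Theory Num.Theory.

Local Open Scope ring_scope.
Local Open Scope complex_scope.

(** * Polynomial functions *)

Section PolynomialFunctions.

Variable C : numFieldType.
Implicit Types (P : {poly C}) (phi psi : C -> C).

Lemma poly_natr_eq0 P : (forall m : nat, P.[m%:R] = 0) -> P = 0.
Proof.
move=> P0; apply: (@roots_geq_poly_eq0 _ _ [seq m%:R | m <- iota 0 (size P)]).
- by apply/allP => _ /mapP[m _ ->]; rewrite /root P0.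
- by rewrite map_inj_uniq ?iota_uniq // => a b /eqP; rewrite eqr_nat => /eqP.
- by rewrite size_map size_iota.
Qed.

Definition polyfun phi := exists P, forall s, phi s = P.[s].

Lemma polyfun_eq0 phi : polyfun phi -> (forall m : nat, phi m%:R = 0) ->
  forall s, phi s = 0.
Proof.
move=> [P phiP] phi0 s; rewrite phiP (_ : P = 0) ?horner0 //.
by apply: poly_natr_eq0 => m; rewrite -phiP.
Qed.

Lemma eq_polyfun phi psi : phi =1 psi -> polyfun phi -> polyfun psi.
Proof. by move=> e [P phiP]; exists P => s; rewrite -e. Qed.

Lemma polyfun_cst c : polyfun (fun=> c).
Proof. by exists c%:P => s; rewrite hornerC. Qed.

Lemma polyfun_id : polyfun id.
Proof. by exists 'X => s; rewrite hornerX. Qed.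

Lemma polyfunD phi psi :
  polyfun phi -> polyfun psi -> polyfun (fun s => phi s + psi s).
Proof. by move=> [P hP] [Q hQ]; exists (P + Q) => s; rewrite hornerD hP hQ. Qed.

Lemma polyfunM phi psi :
  polyfun phi -> polyfun psi -> polyfun (fun s => phi s * psi s).
Proof. by move=> [P hP] [Q hQ]; exists (P * Q) => s; rewrite hornerM hP hQ. Qed.

Lemma polyfunX phi m : polyfun phi -> polyfun (fun s => phi s ^+ m).
Proof. by move=> [P hP]; exists (P ^+ m) => s; rewrite horner_exp hP. Qed.

Lemma polyfun_sum (I : finType) (F : I -> C -> C) :
  (forall i, polyfun (F i)) -> polyfun (fun s => \sum_i F i s).
Proof.
move=> /choice[P hP]; exists (\sum_i P i) => s.
by rewrite horner_sum; apply: eq_bigr => i _.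
Qed.

Lemma polyfun_coef_exp (u v : {poly C}) m j :
  polyfun (fun s => ((u + s *: v) ^+ m)`_j).
Proof.
elim: m j => [|m IH] j.
  by exists ((1 : {poly C})`_j)%:P => s; rewrite expr0 hornerC.
apply: (@eq_polyfun (fun s => \sum_(k < j.+1)
   (u`_k + s * v`_k) * ((u + s *: v) ^+ m)`_(j - k))).
  by move=> s; rewrite exprS coefM; apply: eq_bigr => k _; rewrite coefD coefZ.
apply: polyfun_sum => k; apply: polyfunM (IH _).
by apply: polyfunD (polyfun_cst _) (polyfunM polyfun_id (polyfun_cst _)).
Qed.

(** Zariski density of the integer polynomials: coefficients are freed one at a time, each being a
    variable in which [Psi] is polynomial and vanishes at all natural numbers. *)
Lemma poly_density (Psi : {poly C} -> C) (c : C) :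
  (forall u v, polyfun (fun s => Psi (u + s *: v))) ->
  (forall a : {poly int}, Psi (map_poly intr a \Po ('X + c%:P)) = 0) ->
  forall h, Psi h = 0.
Proof.
move=> Psipol Psi0 h.
(* [g] holds the coefficients already freed, all below degree [m]; [a] holds the integer ones. *)
suff H m : forall (a : {poly int}) (g : {poly C}), (size g <= m)%N ->
    Psi ((map_poly intr a + g) \Po ('X + c%:P)) = 0.
  have := H _ 0 (h \Po ('X - c%:P)) (leqnn _).
  rewrite rmorph0 add0r -comp_polyA comp_polyB comp_polyX comp_polyC addrK.
  by rewrite comp_polyXr.
elim: m => [|m IH] a g.
  by rewrite leqn0 size_poly_eq0 => /eqP ->; rewrite addr0.
move=> sg.
have -> : g = \poly_(i < m) g`_i + g`_m *: 'X^m.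
  apply/polyP => i; rewrite coefD coef_poly coefZ coefXn.
  case: ltngtP => [_|mi|->]; rewrite ?mulr0 ?mulr1 ?addr0 ?add0r //.
  by rewrite nth_default // (leq_trans sg).
rewrite addrA comp_polyD comp_polyZ; move: (g`_m).
(* For natural [s] the monomial [s X^m] is absorbed into the integer part, which leaves a [g] with
   one coefficient fewer. *)
apply: polyfun_eq0 => [|s]; first exact: Psipol.
rewrite -comp_polyZ -comp_polyD -addrA (addrC (\poly_(i < m) _)) addrA.
have -> : map_poly intr a + s%:R *: 'X^m =
    map_poly (intr : int -> C) (a + s%:R *: 'X^m).
  by rewrite rmorphD /= map_polyZ /= map_polyXn rmorph_nat.
by apply: IH; rewrite size_poly.
Qed.

End PolynomialFunctions.

(** * Jets *)

Section PolynomialIdentities.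

Variable C : numFieldType.
Implicit Types (u v w : {poly C}).

Lemma coef_linear_exp (t g : C) m e :
  ((t%:P + g%:P * 'X) ^+ m)`_e = 'C(m, e)%:R * t ^+ (m - e) * g ^+ e.
Proof.
rewrite exprDn coef_sum.
have E (i : 'I_m.+1) : ((t%:P ^+ (m - i) * (g%:P * 'X) ^+ i) *+ 'C(m, i))`_e
    = if i == e :> nat then 'C(m, e)%:R * t ^+ (m - e) * g ^+ e else 0.
  rewrite coefMn exprMn -!rmorphXn mulrA -rmorphM coefCM coefXn eq_sym.
  by case: eqP => [->|_]; rewrite ?mulr0 ?mul0rn // mulr1 -mulrA [RHS]mulr_natl.
rewrite (eq_bigr _ (fun i _ => E i)) -big_mkcond /=.
have [em|me] := ltnP e m.+1; first by rewrite (big_pred1 (Ordinal em)).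
rewrite bin_small // !mul0r big_pred0 // => i.
by apply/eqP => ie; have := ltn_ord i; rewrite ie ltnNge me.
Qed.

Lemma coef0_exp u m : (u ^+ m)`_0 = u`_0 ^+ m.
Proof. by rewrite -!horner_coef0 horner_exp. Qed.

Lemma poly_eq0_horner (P : {poly C}) : (forall s, P.[s] = 0) -> P = 0.
Proof. by move=> P0; apply: poly_natr_eq0. Qed.

(** Among the [i] with [g i != 0], the one with the largest exponent would alone contribute to the
    coefficient of [z ^ e i], since [P] has smaller degree. *)
Lemma power_sum_const (I : finType) (J : pred I) (c t g : I -> C) (e : I -> nat)
    (P : {poly C}) :
  (forall i, J i -> c i != 0) -> {in J &, injective e} ->
  (forall i, J i -> 0 < e i)%N -> (forall i, J i -> size P <= e i)%N ->
  (forall z, P.[z] + \sum_(i | J i) c i * (t i + z * g i) ^+ e i = 0) ->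
  forall i, J i -> g i = 0.
Proof.
move=> c_neq0 e_inj e_gt0 Pe PS i0 Ji0; apply/eqP/negP => /negP gi0.
have [|a /andP[Ja ga] a_max] :=
    @arg_maxnP _ i0 (fun i => J i && (g i != 0)) e _; first by rewrite Ji0.
pose Q := P + \sum_(i | J i) (c i)%:P * ((t i)%:P + (g i)%:P * 'X) ^+ e i.
have Q0 : Q = 0.
  apply: poly_eq0_horner => z; rewrite -(PS z) hornerD horner_sum.
  congr (_ + _); apply: eq_bigr => i _.
  by rewrite !hornerE (mulrC z).
have : Q`_(e a) = 0 by rewrite Q0 coef0.
rewrite coefD nth_default ?Pe // add0r coef_sum (bigD1 a) //= big1 => [|i].
  rewrite coefCM coef_linear_exp binn subnn expr0 addr0 !mul1r => /eqP.
  by rewrite mulf_eq0 (negPf (c_neq0 _ Ja)) expf_eq0 (negPf ga) andbF.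
move=> /andP[Ji ia]; rewrite coefCM coef_linear_exp.
have [gi|gi] := eqVneq (g i) 0.
  by rewrite gi expr0n (gtn_eqF (e_gt0 _ Ja)) !mulr0.
have ea : (e i <= e a)%N by apply: a_max; rewrite Ji gi.
rewrite bin_small ?mul0r ?mulr0 // ltn_neqAle ea andbT.
by apply: contra ia => /eqP/e_inj ->.
Qed.

Lemma exprD_order3 u v m : exists w,
  (u + v) ^+ m = u ^+ m + m%:R * (v * u ^+ m.-1)
                 + 'C(m, 2)%:R * (v ^+ 2 * u ^+ m.-2) + v ^+ 3 * w.
Proof.
elim: m => [|m [w IH]].
  by exists 0; rewrite bin0n !expr0 !mul0r mulr0 !addr0.
exists ((u + v) * w + 'C(m, 2)%:R * u ^+ m.-2).
rewrite exprS {}IH binS bin1 natrD -natr1.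
case: m => [|[|m]] /=.
- by rewrite bin_small //; ring.
- by rewrite bin_small //; ring.
by rewrite !exprS; ring.
Qed.

Lemma exprD_order2 u v m : exists w,
  (u + v) ^+ m = u ^+ m + m%:R * (v * u ^+ m.-1) + v ^+ 2 * w.
Proof.
have [w ->] := exprD_order3 u v m.
by exists ('C(m, 2)%:R * u ^+ m.-2 + v * w); ring.
Qed.

(** A mixed second difference of the [m]-th power at 1. For [v = T], [w = T^(K-1)] and [K > 1], a
    jet of order [K] sees only the term [m (m - 1) v w]. *)
Lemma exprD_mixed v w m : exists a b,
  (1 + v + w) ^+ m - (1 + v) ^+ m - (1 + w) ^+ m + 1 =
  v * w * ((m * m.-1)%:R + v * a + w * b).
Proof.
elim: m => [|m [a [b IH]]].
  by exists 0, 0; rewrite !expr0 mul0n !mulr0 !addr0 mulr0; ring.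
have [v' Ev] := exprD_order2 1 v m; have [w' Ew] := exprD_order2 1 w m.
rewrite !expr1n !mulr1 in Ev Ew.
exists ((m * m.-1)%:R + (1 + v + w) * a + v'),
  ((m * m.-1)%:R + (1 + v + w) * b + w').
have -> : (1 + v + w) ^+ m.+1 = (1 + v + w) *
   (((1 + v + w) ^+ m - (1 + v) ^+ m - (1 + w) ^+ m + 1) +
    (1 + v) ^+ m + (1 + w) ^+ m - 1) by rewrite exprS; ring.
rewrite IH !exprS Ev Ew.
have -> : (m.+1 * m.+1.-1 = m * m.-1 + m.*2)%N.
  by rewrite /=; case: m {IH Ev Ew} => //= m; lia.
by rewrite natrD -mul2n natrM; ring.
Qed.

End PolynomialIdentities.

(** * Linear forms in the first coefficients of a polynomial *)

Section Jets.

Variables (C : numFieldType) (K : nat).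
Implicit Types (a : nat -> C) (h u v w : {poly C}) (m : nat) (s : C).

(** With [a j] equal to [(ad y)^j f(1)] and [h] equal to [P(y + T)], this is the Taylor formula for
    [f(P(y))]; see [jet_ad]. *)
Definition jet a h : C := \sum_(j < K.+1) a j * h`_j.

Lemma jetD a h v : jet a (h + v) = jet a h + jet a v.
Proof. by rewrite -big_split; apply: eq_bigr => j _; rewrite coefD mulrDr. Qed.

Lemma jetZ a s h : jet a (s *: h) = s * jet a h.
Proof. by rewrite mulr_sumr; apply: eq_bigr => j _; rewrite coefZ mulrCA. Qed.

Lemma jetN a h : jet a (- h) = - jet a h.
Proof. by rewrite -scaleN1r jetZ mulN1r. Qed.

Lemma jetMn a h m : jet a (h *+ m) = m%:R * jet a h.
Proof. by rewrite -scaler_nat jetZ. Qed.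

Lemma jet1 a : jet a 1 = a 0%N.
Proof.
rewrite /jet big_ord_recl coef1 eqxx mulr1 big1 ?addr0 // => j _.
by rewrite coef1 mulr0.
Qed.

Lemma jetXnM a m w : (m <= K)%N -> (forall j, (m < j)%N -> a j = 0) ->
  jet a ('X^m * w) = a m * w`_0.
Proof.
rewrite -ltnS => mK am; rewrite /jet (bigD1 (Ordinal mK)) //= big1 => [|j jm].
  by rewrite coefXnM ltnn subnn addr0.
rewrite coefXnM; case: ltngtP => [_|mj|mj]; rewrite ?mulr0 //.
  by rewrite am ?mul0r.
by case/eqP: jm; apply: val_inj.
Qed.

Lemma jetXnM0 a m w : (forall j, (m <= j)%N -> a j = 0) -> jet a ('X^m * w) = 0.
Proof.
move=> am; rewrite /jet big1 // => j _; rewrite coefXnM.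
by case: ltnP => [_|mj]; rewrite ?mulr0 ?am ?mul0r.
Qed.

(** The part of order two in [s] is divisible by [T^(2m)], beyond the last nonzero [a j]; the linear
    part only meets the constant coefficient of [u^(e-1)], which is 1. *)
Lemma jet_exp a u s m e : (0 < m <= K)%N -> (forall j, (m < j)%N -> a j = 0) ->
  u`_0 = 1 ->
  jet a ((u + s *: 'X^m) ^+ e) = jet a (u ^+ e) + s * (e%:R * a m).
Proof.
move=> /andP[m0 mK] am u0; have [w ->] := exprD_order2 u (s *: 'X^m) e.
have -> : (s *: 'X^m) ^+ 2 * w = 'X^m * (s ^+ 2 *: ('X^m * w)).
  by rewrite exprZn -!scalerAl -scalerAr expr2 mulrA.
rewrite !jetD mulr_natl jetMn -scalerAl jetZ !jetXnM // coefZ coefXnM m0.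
by rewrite coef0_exp u0 expr1n; ring.
Qed.

Lemma jet_exp1 a s m e : (0 < m <= K)%N -> (forall j, (m < j)%N -> a j = 0) ->
  jet a ((1 + s *: 'X^m) ^+ e) = a 0%N + s * (e%:R * a m).
Proof. by move=> mK am; rewrite jet_exp ?coef1 // expr1n jet1. Qed.

Lemma jet_shift a u s m : (0 < m <= K)%N -> (forall j, (m < j)%N -> a j = 0) ->
  u`_0 = 1 -> jet a (u + s *: 'X^m) = jet a u + s * a m.
Proof. by move=> mK am u0; have := jet_exp s 1 mK am u0; rewrite !expr1 mul1r. Qed.

(** Meant for [m = K - 1], where squares in [s] may survive but cubes lie beyond degree [K]. *)
Lemma jet_exp_quadratic a m e : (K < 3 * m)%N -> exists P : {poly C},
  (size P <= 3)%N /\ forall s, jet a ((1 + s *: 'X^m) ^+ e) = P.[s].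
Proof.
move=> Km; pose c1 := e%:R * jet a 'X^m; pose c2 := 'C(e, 2)%:R * jet a ('X^m ^+ 2).
exists (Poly [:: a 0%N; c1; c2]); split=> [|s]; first exact: size_Poly.
have [w ->] := exprD_order3 1 (s *: 'X^m) e.
have -> : (s *: 'X^m) ^+ 3 * w = s ^+ 3 *: ('X^(3 * m) * w).
  by rewrite exprZn -exprM mulnC scalerAl.
rewrite !jetD !expr1n !mulr1 jet1 !mulr_natl !jetMn exprZn !jetZ.
rewrite (_ : jet a ('X^(3 * m) * w) = 0) ?mulr0 ?addr0.
  by rewrite horner_Poly /= /c1 /c2; ring.
by rewrite /jet big1 // => j _; rewrite coefXnM (leq_trans (ltn_ord j)) ?mulr0.
Qed.

Lemma jet_exp_mixed a e : (1 < K)%N ->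
  jet a ((1 + 'X + 'X^(K.-1)) ^+ e) - jet a ((1 + 'X) ^+ e)
  - jet a ((1 + 'X^(K.-1)) ^+ e) + jet a 1 = (e * e.-1)%:R * a K.
Proof.
move=> K1; have [x [y E]] := exprD_mixed ('X : {poly C}) 'X^(K.-1) e.
rewrite -!jetN -!jetD E -exprS prednK ?(ltnW K1) //.
rewrite /jet big_ord_recr /= big1 => [|j _]; last first.
  by rewrite coefXnM ltn_ord mulr0.
rewrite coefXnM ltnn subnn add0r !coefD coefXM coefXnM -polyC_natr coefC /=.
by case: K K1 => [|[]] // *; rewrite /= !addr0 mulrC.
Qed.

(** * Powers of [s] in the jet identity along [u + s T^K] *)

Section Equation.

Variables (n : nat) (p q : 'I_n -> nat) (phi gam : 'I_n -> nat -> C).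
Hypothesis K_gt0 : (0 < K)%N.
Hypothesis phi_gt : forall i j, (K < j)%N -> phi i j = 0.
Hypothesis gam_gt : forall i j, (K < j)%N -> gam i j = 0.
Hypothesis jet_eq0 : forall h,
  \sum_i jet (phi i) (h ^+ p i) * jet (gam i) h ^+ q i = 0.

(** This is the coefficient of [s^(e+1)]: each summand is an affine function of [s] times a power of
    another. Where a subtraction truncates, the binomial coefficient vanishes. *)
Lemma jet_coef u e : u`_0 = 1 ->
  \sum_i (jet (phi i) (u ^+ p i) *
            ('C(q i, e.+1)%:R * jet (gam i) u ^+ (q i - e.+1) * gam i K ^+ e.+1) +
          (p i)%:R * phi i K *
            ('C(q i, e)%:R * jet (gam i) u ^+ (q i - e) * gam i K ^+ e)) = 0.
Proof.
move=> u0.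
pose P := \sum_i ((jet (phi i) (u ^+ p i))%:P + ((p i)%:R * phi i K)%:P * 'X) *
  ((jet (gam i) u)%:P + (gam i K)%:P * 'X) ^+ q i.
have P0 : P = 0.
  apply: poly_eq0_horner => s; rewrite -[RHS](jet_eq0 (u + s *: 'X^K)) horner_sum.
  apply: eq_bigr => i _; rewrite !hornerE.
  rewrite jet_exp ?K_gt0 ?leqnn //; last exact: phi_gt.
  rewrite jet_shift ?K_gt0 ?leqnn //; last exact: gam_gt.
  by rewrite (mulrC s) (mulrC s).
have : P`_e.+1 = 0 by rewrite P0 coef0.
rewrite coef_sum => E; rewrite -[RHS]E; apply: eq_bigr => i _.
by rewrite [in RHS]mulrDl coefD coefCM -(mulrA _%:P) coefCM coefXM !coef_linear_exp.
Qed.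

(** The coefficient of [s ^ q a] at [u = 1]: only [a], through the constant part of its first
    factor, and [b], through the linear part, reach this power. *)
Lemma jet_top_coef (a b : 'I_n) : injective q -> (0 < q b)%N -> q a = (q b).+1 ->
  phi a K = 0 -> (forall i, gam i K != 0 -> (q i <= q a)%N) ->
  (p b)%:R * phi b K * gam b K ^+ q b + phi a 0%N * gam a K ^+ (q b).+1 = 0.
Proof.
move=> q_inj qb0 qab phia q_max.
have ba : b != a by apply/eqP => ba; move: qab; rewrite ba; lia.
have := jet_coef (q b) (coef1 _ 0).
rewrite (bigD1 a) //= (bigD1 b) //= big1 => [|i /andP[ia ib]].
  rewrite !expr1n !jet1 qab !binn !subnn !expr0 !mul1r addr0 phia.
  by rewrite mulr0 mul0r addr0 bin_small // !mul0r mulr0 add0r addrC.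
have [->|/q_max] := eqVneq (gam i K) 0.
  by rewrite !expr0n (gtn_eqF qb0) /= !mulr0 addr0.
rewrite leq_eqVlt (inj_eq q_inj) (negPf ia) qab ltnS.
rewrite leq_eqVlt (inj_eq q_inj) (negPf ib) /= => qi.
have [c0 c1] : (q i < q b)%N /\ (q i < (q b).+1)%N by rewrite ltnS (ltnW qi).
by rewrite (bin_small c0) (bin_small c1) !(mul0r, mulr0, addr0).
Qed.

End Equation.

End Jets.

(** * Orders compatible with the jet identity *)

Section JetDichotomy.

Variables (C : numFieldType) (K n N : nat).
Implicit Types (u : {poly C}) (s c : C).
Variables (p q k l : 'I_n -> nat) (phi gam : 'I_n -> nat -> C).
Hypothesis p_gt0 : forall i, (0 < p i)%N.
Hypothesis q_gt0 : forall i, (0 < q i)%N.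
Hypothesis pqN : forall i, (p i + q i)%N = N.
Hypothesis q_inj : injective q.
Hypothesis K_gt0 : (0 < K)%N.
Hypothesis k_le : forall i, (k i <= K)%N.
Hypothesis l_le : forall i, (l i <= K)%N.
Hypothesis phi_k : forall i, phi i (k i) != 0.
Hypothesis gam_l : forall i, gam i (l i) != 0.
Hypothesis phi_gt : forall i j, (k i < j)%N -> phi i j = 0.
Hypothesis gam_gt : forall i j, (l i < j)%N -> gam i j = 0.
Hypothesis order_attained : exists i, k i = K \/ l i = K.
(** The failure of alternative (A), expressed by orders. *)
Hypothesis l_neq0 : forall i, k i = K -> l i != 0%N.
Hypothesis eq0 : forall h : {poly C},
  \sum_i jet K (phi i) (h ^+ p i) * jet K (gam i) h ^+ q i = 0.

Let F i (u : {poly C}) := jet K (phi i) (u ^+ p i).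
Let G i (u : {poly C}) := jet K (gam i) u.

Let phiK i : phi i K != 0 -> k i = K.
Proof.
by move=> h; apply/eqP; rewrite eqn_leq k_le leqNgt; apply: contra h => /phi_gt->.
Qed.

Let gamK i : gam i K != 0 -> l i = K.
Proof.
by move=> h; apply/eqP; rewrite eqn_leq l_le leqNgt; apply: contra h => /gam_gt->.
Qed.

Let natp_neq0 i : (p i)%:R != 0 :> C.
Proof. by rewrite pnatr_eq0 -lt0n. Qed.

Let jet_phi_shift i s m : (0 < m <= K)%N -> (k i <= m)%N ->
  F i (1 + s *: 'X^m) = phi i 0%N + s * ((p i)%:R * phi i m).
Proof.
by move=> mK ki; rewrite /F jet_exp1 // => j /(leq_ltn_trans ki)/phi_gt.
Qed.

Let jet_gam_shift i s m : (0 < m <= K)%N -> (l i <= m)%N ->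
  G i (1 + s *: 'X^m) = gam i 0%N + s * gam i m.
Proof.
move=> mK li; rewrite /G jet_shift ?coef1 ?jet1 // => j.
by move/(leq_ltn_trans li)/gam_gt.
Qed.

Let coef0_shift s m : (0 < m)%N -> (1 + s *: 'X^m : {poly C})`_0 = 1.
Proof. by case: m => // m _; rewrite coefD coef1 coefZ coefXn mulr0 addr0. Qed.

Let coef_eq u e : u`_0 = 1 ->
  \sum_i (F i u * ('C(q i, e.+1)%:R * G i u ^+ (q i - e.+1) * gam i K ^+ e.+1) +
          (p i)%:R * phi i K * ('C(q i, e)%:R * G i u ^+ (q i - e) * gam i K ^+ e))
  = 0.
Proof.
apply: jet_coef => // i j Kj; first by apply: phi_gt; apply: leq_ltn_trans Kj.
by apply: gam_gt; apply: leq_ltn_trans Kj.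
Qed.

(* Comparing leading coefficients along [1 + z T^m], for [m = K, K - 1, ..., 1],
   bounds all the orders involved by [m - 1]. *)
Lemma top_order_equation a c :
  (forall u, u`_0 = 1 ->
     c * F a u + \sum_(i | k i == K) (p i)%:R * phi i K * G i u ^+ q i = 0) ->
  (c != 0 -> forall i, k i = K -> (1 < q i)%N) ->
  c = 0 /\ forall i, k i != K.
Proof.
move=> E qi.
(* For [c = 0] the form [F a] is absent from the equation, so nothing is claimed about [k a]. *)
pose bounded m := (c != 0 -> (k a <= m)%N) /\ forall i, k i = K -> (l i <= m)%N.
have step m : (m.+1 <= K)%N -> bounded m.+1 -> bounded m.
  move=> mK [ka lm].
  have g0 i : k i == K -> gam i m.+1 = 0.
    (* [c * F a] along [1 + z T^(m+1)]: its degree is at most 1, below every [q i] concerned. *)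
    pose P : {poly C} := (c * phi a 0%N)%:P + (c * ((p a)%:R * phi a m.+1))%:P * 'X.
    move: i; apply: (@power_sum_const _ _ (fun i => k i == K)
      (fun i => (p i)%:R * phi i K) (fun i => gam i 0%N) _ q P) => //.
    - by move=> i /eqP kK; rewrite mulf_neq0 // -kK.
    - by move=> i j _ _; apply: q_inj.
    - move=> i /eqP kK; rewrite /P; have [->|c0] := eqVneq c 0.
        by rewrite !(mul0r, polyC0, addr0) size_poly0.
      apply: leq_trans (qi c0 _ kK); rewrite (leq_trans (size_polyD _ _)) // geq_max.
      rewrite (leq_trans (size_polyC_leq1 _)) //= mul_polyC.
      by rewrite (leq_trans (size_scale_leq _ _)) // size_polyX.
    move=> z; rewrite -[RHS](E (1 + z *: 'X^(m.+1))) ?coef0_shift //.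
    congr (_ + _); last first.
      by apply: eq_bigr => i /eqP/lm li; rewrite jet_gam_shift.
    rewrite /P hornerD hornerC hornerCM hornerX; have [->|c0] := eqVneq c 0.
      by rewrite !(mul0r, addr0).
    by rewrite jet_phi_shift ?ka //; ring.
  split=> [c0|i kK]; last first.
    rewrite -ltnS ltn_neqAle lm // andbT; apply/eqP => lim.
    by have := gam_l i; rewrite lim g0 ?kK ?eqxx.
  (* The sum now agrees at [1] and at [1 + T^(m+1)], so [F a] must agree there too; this contradicts
     [k a = m + 1]. *)
  rewrite -ltnS ltn_neqAle ka // andbT; apply/eqP => kam.
  have := etrans (E _ (coef0_shift 1 (ltn0Sn m))) (esym (E _ (coef1 _ 0))).
  rewrite jet_phi_shift ?ka //.
  rewrite (eq_bigr (fun i => (p i)%:R * phi i K * G i 1 ^+ q i)); last first.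
    by move=> i ki; rewrite jet_gam_shift ?lm ?(eqP ki) // g0 // mulr0 addr0 /G jet1.
  move=> /addIr/(mulfI c0)/eqP; rewrite /F expr1n jet1 mul1r.
  rewrite -subr_eq0 addrAC subrr add0r -kam mulf_eq0 (negPf (natp_neq0 a)) /=.
  by rewrite (negPf (phi_k a)).
have descend m : (m <= K)%N -> bounded m -> bounded 0%N.
  by elim: m => // m IH mK /(step _ mK); apply: IH; apply: ltnW.
have [ka l0] : bounded 0%N by apply: (descend K).
have kK i : k i != K.
  by apply/eqP => ki; have := l_neq0 ki; rewrite -leqn0 l0.
split=> //; apply/eqP/negPn/negP => c0; have := E 1.
rewrite coef1 big_pred0 => [/(_ erefl)|i]; last exact: negbTE (kK i).
move/eqP; rewrite addr0 mulf_eq0 (negPf c0) /F expr1n jet1 /=.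
by have := ka c0; rewrite leqn0 => /eqP <-; rewrite (negPf (phi_k a)).
Qed.

(** Otherwise the coefficient of [s] is the sum of the [p i * phi i K * G i u ^ q i], which
    [top_order_equation] excludes with [c = 0]. *)
Lemma exists_top_gam : exists i, l i = K.
Proof.
apply: contrapT => nl.
have g0 i : gam i K = 0.
  by apply/eqP/negPn/negP => /gamK li; apply: nl; exists i.
have [i [ki|li]] := order_attained; last by case: nl; exists i.
have [|//|_ /(_ i)] := @top_order_equation i 0; last by rewrite ki eqxx.
  move=> u u0; rewrite mul0r add0r -[RHS](coef_eq 0 u0) big_mkcond.
  apply: eq_bigr => j _; rewrite g0 expr0n !mulr0 add0r bin0 mul1r subn0 mulr1.
  by case: eqP => // kj; have [->|/phiK] := eqVneq (phi j K) 0; rewrite ?mulr0 ?mul0r.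
by rewrite eqxx.
Qed.

Section TopIndex.

Variable a : 'I_n.
Hypothesis la : l a = K.
Hypothesis q_max : forall i, l i = K -> (q i <= q a)%N.

Let gaK : gam a K != 0.
Proof. by rewrite -la. Qed.

Let q_lt i : i != a -> gam i K != 0 -> (q i < q a)%N.
Proof.
move=> ia /gamK li; rewrite ltn_neqAle q_max // andbT.
by apply: contra ia => /eqP/q_inj->.
Qed.

(** At [u = 1] only the index [a] contributes to the coefficient of [s^(q a + 1)]. *)
Lemma phi_a_K : phi a K = 0.
Proof.
have := coef_eq (q a) (coef1 _ 0); rewrite (bigD1 a) //= big1 => [|i ia].
  rewrite bin_small // binn subnn expr0 !mul0r mulr0 add0r addr0 !mul1r => /eqP.
  by rewrite !mulf_eq0 (negPf (natp_neq0 _)) expf_eq0 (negPf gaK) andbF orbF => /eqP.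
have [gi|gi] := eqVneq (gam i K) 0.
  by rewrite gi !expr0n (gtn_eqF (q_gt0 a)) /= !mulr0 addr0.
by rewrite !bin_small ?mul0r ?mulr0 ?addr0 // ?ltnS ?(ltnW (q_lt _ _)) ?q_lt.
Qed.

Let ka i : k i = K -> i != a.
Proof. by move=> ki; apply/eqP => ia; have := phi_k i; rewrite ki ia phi_a_K eqxx. Qed.

(** If [q a = 1], then [a] is the only index with [gam i K != 0], and the coefficient of [s] has the
    shape of [top_order_equation] with [c = gam a K]. *)
Lemma q_a_gt1 : (1 < q a)%N.
Proof.
rewrite ltn_neqAle q_gt0 andbT; apply/eqP => qa.
have [|_ i ki|/eqP] := @top_order_equation a (gam a K).
- move=> u u0; rewrite -[RHS](coef_eq 0 u0) big_split /=; congr (_ + _).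
    rewrite (bigD1 a) //= big1 => [|i ia].
      by rewrite -qa binn subnn expr0 mul1r mul1r expr1 addr0 mulrC.
    have [->|gi] := eqVneq (gam i K) 0; first by rewrite expr1 !mulr0.
    by have := q_lt ia gi; rewrite -qa ltnS leqn0 gtn_eqF.
  rewrite big_mkcond; apply: eq_bigr => j _; rewrite bin0 mul1r subn0 expr0 mulr1.
  by case: eqP => // kj; have [->|/phiK] := eqVneq (phi j K) 0; rewrite ?mulr0 ?mul0r.
- rewrite ltn_neqAle q_gt0 andbT qa; apply: contra (ka ki) => /eqP/q_inj->.
  exact: eqxx.
by rewrite (negPf gaK).
Qed.

Lemma exists_partner : k a = 0%N /\ exists2 b, k b = K /\ l b = K & q a = (q b).+1.
Proof.
have q1 := q_a_gt1; have qS := prednK (q_gt0 a).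
(* The contribution of the linear parts of the [F i] to the coefficient of [s ^ q a]. Its nonzero
   summands have [q i = q a - 1], so no power of [G i u] is left and [D] is independent of [u]. *)
pose D := \sum_i (p i)%:R * phi i K *
  ('C(q i, (q a).-1)%:R * gam i K ^+ (q a).-1).
have nz i : phi i K * ('C(q i, (q a).-1)%:R * gam i K ^+ (q a).-1) != 0 ->
    [/\ k i = K, l i = K & q a = (q i).+1].
  rewrite !mulf_eq0 !negb_or => /and3P[/phiK ki Ci gi].
  have gi' : gam i K != 0.
    by apply: contra gi => /eqP->; rewrite expr0n; case: (q a) q1 => [|[]].
  split=> //; first exact: gamK.
  apply/eqP; rewrite eqn_leq (q_lt (ka ki) gi') andbT -qS ltnS leqNgt.
  by apply: contra Ci => qi; rewrite bin_small.
have E u : u`_0 = 1 -> F a u * gam a K ^+ q a + D = 0.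
  move=> u0; rewrite -[RHS](coef_eq (q a).-1 u0) qS big_split /=; congr (_ + _).
    rewrite (bigD1 a) //= big1 => [|i ia].
      by rewrite binn subnn expr0 !mul1r addr0.
    have [->|gi] := eqVneq (gam i K) 0.
      by rewrite expr0n (gtn_eqF (q_gt0 a)) !mulr0.
    by rewrite bin_small ?mul0r ?mulr0 ?q_lt.
  apply: eq_bigr => i _; rewrite -!mulrA; congr (_ * _).
  have [D0|/nz[_ _ qi]] :=
    eqVneq (phi i K * ('C(q i, (q a).-1)%:R * gam i K ^+ (q a).-1)) 0.
    by rewrite (mulrCA _ (G i u ^+ _)) (mulrCA _ (G i u ^+ _)) D0 mulr0.
  by rewrite qi subnn expr0 mul1r.
(* By [E], [F a] is constant on the [u] with constant coefficient 1. *)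
have ka0 : k a = 0%N.
  apply/eqP/negPn/negP; rewrite -lt0n => ka0.
  have /addIr := etrans (E _ (coef0_shift 1 ka0)) (esym (E _ (coef1 _ 0))).
  move/(mulIf (expf_neq0 _ gaK))/eqP; rewrite jet_phi_shift ?ka0 //= /F expr1n jet1.
  rewrite mul1r -subr_eq0 addrAC subrr add0r mulf_eq0 (negPf (natp_neq0 _)).
  by rewrite (negPf (phi_k _)).
split=> //; apply: contrapT => nb.
(* Since [F a 1 = phi a 0] is nonzero, [D] cannot vanish, so it has a nonzero summand. *)
have := E 1; rewrite coef1 => /(_ erefl) /eqP; rewrite /D big1 => [|i _].
  rewrite addr0 mulf_eq0 expf_eq0 (negPf gaK) andbF orbF /F expr1n jet1 -ka0.
  by rewrite (negPf (phi_k _)).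
rewrite -mulrA; have [->|/nz[ki li qi]] :=
    eqVneq (phi i K * ('C(q i, (q a).-1)%:R * gam i K ^+ (q a).-1)) 0.
  by rewrite mulr0.
by case: nb; exists i.
Qed.

(** If [K > 1], the coefficient of [s ^ q b] expresses [F b] through the [G i], which cannot
    reproduce the quadratic dependence of [F b] on [u]. *)
Lemma top_order_eq1 b :
  k a = 0%N -> k b = K -> l b = K -> q a = (q b).+1 -> K = 1%N.
Proof.
move=> ka0 kb lb qab; apply/eqP; rewrite eqn_leq K_gt0 andbT leqNgt.
apply/negP => K1; have qS := prednK (q_gt0 b).
have m0 : (0 < K.-1 <= K)%N by rewrite leq_pred andbT -ltnS prednK.
have gbK : gam b K != 0 by rewrite -lb.
(* The factor [q a] is the binomial coefficient of [q a] over [q b]; [F a] is the constant [phi a 0]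
   because [k a = 0]. *)
pose ca := phi a 0%N * (q a)%:R * gam a K ^+ q b.
pose e i := (p i)%:R * phi i K * ('C(q i, (q b).-1)%:R * gam i K ^+ (q b).-1).
pose S u := \sum_i e i * G i u ^+ (q i - (q b).-1).
have E u : u`_0 = 1 -> F b u * gam b K ^+ q b + ca * G a u + S u = 0.
  move=> u0; rewrite -[RHS](coef_eq (q b).-1 u0) qS big_split /=; congr (_ + _).
    have ab : a != b by apply/eqP => ab; move: qab; rewrite ab; lia.
    rewrite (bigD1 b) //= (bigD1 a) //= big1 => [|i /andP[ib ia]].
      rewrite binn subnn expr0 qab binSn subSnn /ca qab addr0 expr1 !mul1r.
      have -> : F a u = phi a 0%N; last by congr (_ + _); ring.
      rewrite /F -[u ^+ _]mul1r -(expr0 'X) jetXnM // => [|j].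
        by rewrite coef0_exp u0 expr1n mulr1.
      by move=> j0; apply: phi_gt; rewrite ka0.
    have [->|gi] := eqVneq (gam i K) 0.
      by rewrite expr0n (gtn_eqF (q_gt0 b)) !mulr0.
    have := q_lt ia gi; rewrite qab ltnS leq_eqVlt (inj_eq q_inj) (negPf ib) /=.
    by move=> qi; rewrite bin_small ?mul0r ?mulr0.
  by apply: eq_bigr => i _; rewrite /e; ring.
have e_k i : e i != 0 -> k i = K.
  by move=> ei; apply: phiK; apply: contra ei => /eqP; rewrite /e => ->; rewrite mulr0 mul0r.
(* These are the [i] for which [S] contains a power of [G i] above the first; such a [G i] does not
   see [T^(K-1)]. *)
have l_small i : e i != 0 -> i != b -> ((q b).-1 < q i)%N -> (l i < K.-1)%N.
  have l_lt j : e j != 0 -> j != b -> ((q b).-1 < q j)%N -> gam j K = 0.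
    rewrite qS => ej jb qj; apply/eqP/negPn/negP => gj.
    have := q_lt (ka (e_k _ ej)) gj; rewrite qab ltnS leqNgt ltn_neqAle qj andbT.
    by rewrite eq_sym (inj_eq q_inj) jb.
  move=> ei ib qi; have gi := l_lt _ ei ib qi.
  (* As [gam i K = 0], the nonzero [e i] must contain its zeroth power. Hence [q b = 1], [q a = 2],
     and every other [j] with [k j = K] has [q j > 2]. *)
  have qb1 : (q b).-1 = 0%N.
    apply/eqP/negPn/negP => qb; move: ei.
    by rewrite /e gi expr0n (negPf qb) !mulr0 eqxx.
  have eE j : e j = (p j)%:R * phi j K by rewrite /e qb1 bin0 mul1r mulr1.
  have e0 j : k j = K -> e j != 0.
    by move=> kj; rewrite eE mulf_neq0 // -kj.
  have q3 j : (k j == K) && (j != b) -> (2 < q j)%N.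
    case/andP=> /eqP/ka ja jb.
    have : (q j != q a) && (q j != q b) by rewrite !(inj_eq q_inj) ja.
    by have := q_gt0 j; lia.
  have lj j : (k j == K) && (j != b) -> (l j <= K.-1)%N.
    move=> kj; rewrite -ltnS prednK // ltn_neqAle l_le andbT; apply/eqP => ljK.
    case/andP: (kj) => /eqP kjK jb; have := gam_l j; rewrite ljK l_lt ?eqxx ?e0 //.
    by rewrite qb1.
  have [|P [sP FP]] := @jet_exp_quadratic _ K (phi b) K.-1 (p b); first lia.
  pose lin j : {poly C} := (jet K (gam j) 1)%:P + jet K (gam j) 'X^(K.-1) *: 'X.
  have linE j z : G j (1 + z *: 'X^(K.-1)) = (lin j).[z].
    by rewrite /G jetD jetZ /lin !hornerE mulrC.
  have s_lin j c : (size (c *: lin j) <= 3)%N.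
    rewrite (leq_trans (size_scale_leq _ _)) // (leq_trans (size_polyD _ _)) //.
    rewrite geq_max (leq_trans (size_polyC_leq1 _)) //.
    by rewrite (leq_trans (size_scale_leq _ _)) // size_polyX.
  (* Along [1 + z T^(K-1)] the contributions of [F b], [G a] and [G b] have degree at most 2 in [z],
     less than the remaining exponents. *)
  pose Q := gam b K ^+ q b *: P + ca *: lin a + e b *: lin b.
  have sQ : (size Q <= 3)%N.
    rewrite (leq_trans (size_polyD _ _)) // geq_max s_lin andbT.
    rewrite (leq_trans (size_polyD _ _)) // geq_max s_lin andbT.
    by rewrite (leq_trans (size_scale_leq _ _)).
  have gz : gam i K.-1 = 0.
    apply: (@power_sum_const _ _ (fun j => (k j == K) && (j != b)) e
       (fun j => gam j 0%N) (fun j => gam j K.-1) q Q) => //.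
    - by move=> j /andP[/eqP/e0].
    - by move=> j j' _ _; apply: q_inj.
    - by move=> j /q3; apply: leq_trans.
    - move=> z; rewrite -[RHS](E (1 + z *: 'X^(K.-1))); last first.
        by rewrite coef0_shift //; case/andP: m0.
      rewrite /Q !hornerD !hornerZ -!linE -FP /S [X in _ = _ + X](bigD1 b) //= qb1 subn0.
      have -> : q b = 1%N by rewrite -qS qb1.
      rewrite !expr1 (mulrC (gam b K)) -!addrA; do 3!congr (_ + _).
      rewrite [RHS](bigID (fun j => k j == K)) /= [X in _ = _ + X]big1 => [|j].
        rewrite addr0; apply: eq_big => [j|j kj]; first by rewrite andbC.
        by rewrite subn0 jet_gam_shift ?lj.
      case/andP=> _ kj; have [->|/e_k kjK] := eqVneq (e j) 0; first by rewrite mul0r.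
      by rewrite kjK eqxx in kj.
    - by rewrite (e_k _ ei) eqxx.
  have lK : (l i <= K.-1)%N by rewrite lj // (e_k _ ei) eqxx.
  rewrite ltn_neqAle lK andbT; apply/eqP => li.
  by have := gam_l i; rewrite li gz eqxx.
(* The mixed second difference along [T] and [T^(K-1)] kills the terms affine in
   [u], but not [F b], because [u ^ p b] has the monomial [u_1 u_(K-1)]. *)
pose u11 : {poly C} := 1 + 'X + 'X^(K.-1); pose u10 : {poly C} := 1 + 'X.
pose u01 : {poly C} := 1 + 'X^(K.-1).
have c0 m : (0 < m)%N -> ('X^m : {poly C})`_0 = 0 by rewrite coefXn; case: m.
have K0 : (0 < K.-1)%N by case/andP: m0.
have E11 : _ = 0 := E u11 _; have E10 : _ = 0 := E u10 _.
have E01 : _ = 0 := E u01 _; have E00 := E 1 (coef1 _ 0).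
have G_mix i : G i u11 - G i u10 - G i u01 + G i 1 = 0.
  by rewrite /G /u11 /u10 /u01 !jetD; ring.
have S_mix : S u11 - S u10 - S u01 + S 1 = 0.
  rewrite -!sumrB -big_split big1 // => i _ /=; rewrite -!mulrBr -mulrDr.
  have [->|ei] := eqVneq (e i) 0; first by rewrite mul0r.
  have [->|ib] := eqVneq i b.
    have -> : (q b - (q b).-1 = 1)%N by lia.
    by rewrite !expr1 G_mix mulr0.
  have [/(l_small _ ei ib) li|qi] := ltnP (q b).-1 (q i); last first.
    by rewrite (eqP qi) !expr0; ring.
  have X0 : jet K (gam i) 'X^(K.-1) = 0.
    by rewrite -['X^_]mulr1 jetXnM0 // => j Kj; apply: gam_gt; apply: leq_trans Kj.
  have -> : G i u11 = G i u10 by rewrite /G /u11 jetD X0 addr0.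
  have -> : G i u01 = G i 1 by rewrite /G /u01 jetD X0 addr0.
  by ring.
have F_mix : F b u11 - F b u10 - F b u01 + F b 1 = (p b * (p b).-1)%:R * phi b K.
  by rewrite /F expr1n -(jet_exp_mixed _ _ K1).
have : (F b u11 - F b u10 - F b u01 + F b 1) * gam b K ^+ q b = 0.
  transitivity ((F b u11 * gam b K ^+ q b + ca * G a u11 + S u11)
    - (F b u10 * gam b K ^+ q b + ca * G a u10 + S u10)
    - (F b u01 * gam b K ^+ q b + ca * G a u01 + S u01)
    + (F b 1 * gam b K ^+ q b + ca * G a 1 + S 1)
    - ca * (G a u11 - G a u10 - G a u01 + G a 1)
    - (S u11 - S u10 - S u01 + S 1)); first by ring.
  rewrite S_mix G_mix E00 E11 ?E10 ?E01; first by ring.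
  - by rewrite /u01 coefD coef1 c0 // addr0.
  - by rewrite /u10 coefD coef1 coefX addr0.
  - by rewrite /u11 !coefD coef1 coefX c0 // !addr0.
apply/eqP; rewrite F_mix !mulf_neq0 ?expf_neq0 //; last by rewrite -kb.
rewrite pnatr_eq0 muln_eq0 negb_or -!lt0n p_gt0 /=.
(* [p b = p a + 1 > 1], so the factor [p b - 1] is nonzero. *)
by have := pqN a; have := pqN b; have := p_gt0 a; lia.
Qed.

End TopIndex.

Lemma jet_dichotomy : K = 1%N /\ exists a b,
  [/\ l a = K, forall i, l i = K -> (q i <= q a)%N, k a = 0%N,
      k b = K /\ l b = K & q a = (q b).+1].
Proof.
have [i0 /eqP li0] := exists_top_gam.
have [a /eqP la a_max] := @arg_maxnP _ i0 (fun i => l i == K) q li0.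
have q_max i : l i = K -> (q i <= q a)%N by move=> /eqP; apply: a_max.
have [ka [b [kb lb] qab]] := exists_partner la q_max.
by split; [apply: (top_order_eq1 la q_max ka kb lb qab) | exists a, b].
Qed.

End JetDichotomy.

(** * Higher order derivations as differential operators *)

Section DifferentialOperators.

Variables (R : realType) (A : pred R[i]) (F : subFieldType A).
Local Notation C := R[i].
Implicit Types (f d : F -> C) (x y z : F).

(* The commutator of [f] with multiplication by [y]. The functions in
   [wide_hder k] are the differential operators of order at most [k] in the
   sense of Grothendieck: those killed by any [k + 1] such commutators. *)
Definition ad y f : F -> C := fun x => f (x * y) - \val y * f x.

Lemma additive_funB f x y : additive_fun f -> f (x - y) = f x - f y.
Proof. by move=> fD; rewrite -[in RHS](subrK y x) [in RHS]fD addrK. Qed.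

Lemma additive_fun0 f : additive_fun f -> f 0 = 0.
Proof. by move=> fD; rewrite -(subrr 0) additive_funB // subrr. Qed.

Lemma additive_funMn f x m : additive_fun f -> f (m%:R * x) = m%:R * f x.
Proof.
move=> fD; elim: m => [|m IH]; first by rewrite !mul0r additive_fun0.
by rewrite -natr1 mulrDl mul1r fD IH -natr1 mulrDl mul1r.
Qed.

Lemma additive_funMz f x (m : int) : additive_fun f -> f (m%:~R * x) = m%:~R * f x.
Proof.
move=> fD; case: m => m; first exact: additive_funMn.
rewrite NegzE !intrN !mulNr -[- _ in LHS]add0r additive_funB // additive_fun0 //.
by rewrite additive_funMn // sub0r.
Qed.

Lemma additive_ad y f : additive_fun f -> additive_fun (ad y f).
Proof. by move=> fD u v; rewrite /ad mulrDl !fD; ring. Qed.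

Lemma additive_iter_ad y f m : additive_fun f -> additive_fun (iter m (ad y) f).
Proof. by move=> fD; elim: m => //= m; apply: additive_ad. Qed.

Lemma adC y z f : ad y (ad z f) = ad z (ad y f).
Proof. by apply/funext => x; rewrite /ad [x * z * y]mulrAC; ring. Qed.

Lemma iter_adC y z f m : iter m (ad y) (ad z f) = ad z (iter m (ad y) f).
Proof. by elim: m => //= m ->; rewrite adC. Qed.

Lemma hder1 k f : hder k f -> f 1 = 0.
Proof.
elim: k f => [f f0|k IH f [_ [B [_ /(_ 1)/IH B1 BE]]]]; first exact: f0.
by have := BE 1 1; rewrite B1 mulr1 rmorph1 mul1r mulr1 subrr sub0r => /eqP;
  rewrite oppr_eq0 => /eqP.
Qed.

Lemma eq_hder k f d : f =1 d -> hder k f -> hder k d.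
Proof. by move=> /funext->. Qed.

Lemma wide_hder_ad k f y : wide_hder k.+1 f -> wide_hder k (ad y f).
Proof.
move=> [D [c [[_ [B [Bl _ BE]]] fE]]]; exists (fun x => B x y), (D y).
split=> [|x]; first exact: Bl.
by rewrite /ad !fE -BE rmorphM; ring.
Qed.

Lemma wide_hder0 f : wide_hder 0 f -> forall x, f x = f 1 * \val x.
Proof.
by move=> [D [c [D0 fE]]] x; rewrite !fE !D0 rmorph1 !add0r mulr1.
Qed.

(** Subtracting [f 1] times the identity gives a [D] whose defect [B(x, y)] is [ad y f x] without
    its linear term; [B] is symmetric, so one variable suffices. *)
Lemma wide_hderS k f : additive_fun f -> (forall y, wide_hder k (ad y f)) ->
  wide_hder k.+1 f.
Proof.
move=> fD adf; pose D x := f x - f 1 * \val x.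
exists D, (f 1); split=> [|x]; last by rewrite subrK.
have hB y : hder k (fun x => D (x * y) - \val x * D y - D x * \val y).
  have [E [c [hE adE]]] := adf y; apply: (eq_hder _ hE) => x.
  have := adE 1; rewrite (hder1 hE) /ad mul1r rmorph1 add0r mulr1 => cE.
  have -> : E x = ad y f x - c * \val x by rewrite adE addrK.
  by rewrite /D /ad -cE rmorphM; ring.
split; first by move=> x y; rewrite /D fD rmorphD; ring.
exists (fun x y => D (x * y) - \val x * D y - D x * \val y); split=> // x.
by apply: eq_hder (hB x) => y; rewrite (mulrC y x); ring.
Qed.

Lemma iter_ad_eq0 k f y j x : wide_hder k f -> (k < j)%N -> iter j (ad y) f x = 0.
Proof.
elim: k f j => [|k IH] f [//|j] hf kj; rewrite iterSr; last first.
  by apply: IH kj; apply: wide_hder_ad.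
have -> : ad y f = fun=> 0.
  apply/funext => z; have E := wide_hder0 hf.
  by rewrite /ad (E (z * y)) (E z) rmorphM; ring.
by elim: j x {kj} => //= j IH x; rewrite /ad !IH mulr0 subrr.
Qed.

(** On additive functions [ad (y + s z) = ad y + s ad z] for natural [s], and these operators
    commute: the binomial expansion, of which two coefficients are recorded. *)
Lemma iter_ad_line f y z j : additive_fun f -> exists P : F -> {poly C},
  [/\ forall x (s : nat), iter j (ad (y + s%:R * z)) f x = (P x).[s%:R],
      forall x, (P x)`_0 = iter j (ad y) f x &
      forall x, (P x)`_1 = j%:R * iter j.-1 (ad y) (ad z f) x].
Proof.
move=> fD; elim: j => [|j [P [PE P0 P1]]].
  exists (fun x => (f x)%:P); split=> x //; first by move=> s; rewrite hornerC.
    by rewrite coefC.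
  by rewrite coefC mul0r.
exists (fun x => P (x * y) - (\val y)%:P * P x
                 + 'X * (P (x * z) - (\val z)%:P * P x)).
split=> [x s|x|x].
- have fD' := additive_iter_ad (y + s%:R * z) j fD.
  rewrite iterS {1}/ad mulrDr fD' (mulrCA x) additive_funMn // !PE.
  by rewrite rmorphD rmorphM rmorph_nat !hornerE; ring.
- by rewrite !coefD coefN coefCM coefXM addr0 !P0.
rewrite !coefD !coefN !coefCM coefXM /= coefD coefN coefCM !P0 !P1.
case: j {PE P0 P1} => [|j] /=; first by rewrite /ad; ring.
rewrite -[j.+2%:R]natr1 !iter_adC /=.
by rewrite {4}/ad /ad /= [x * z * y]mulrAC; ring.
Qed.

(** Polarization: the linear coefficient in [s] of the vanishing iterate along [y + s z] shows that
    each [ad z f] satisfies the same hypothesis one order lower. *)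
Lemma wide_hder_pred k f : additive_fun f -> wide_hder k.+1 f ->
  (forall y, iter k.+1 (ad y) f 1 = 0) -> wide_hder k f.
Proof.
elim: k f => [|k IH] f fD hf f0.
  exists (fun=> 0), (f 1); split=> // y; rewrite add0r; apply/eqP.
  by have := f0 y; rewrite /= /ad mul1r mulrC => /eqP; rewrite subr_eq0.
apply: wide_hderS => // z; apply: IH; first exact: additive_ad.
  exact: wide_hder_ad.
move=> y; have [P [PE _ P1]] := iter_ad_line y z k.+2 fD.
have P0 : P 1 = 0 by apply: poly_natr_eq0 => s; rewrite -PE f0.
have := P1 1; rewrite P0 coef0 => /esym/eqP; rewrite mulf_eq0 pnatr_eq0 /=.
by move/eqP.
Qed.

Lemma wide_orderP f : is_wide_hder f ->
  wide_hder (wide_order f) f /\ forall j, wide_hder j f -> (wide_order f <= j)%N.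
Proof.
move=> [k0 hk0]; rewrite /wide_order; case: xgetP => [k -> []//|nk].
have [k /asboolP hk kmin] :=
  ex_minnP (ex_intro (fun k => `[< wide_hder k f >]) k0 (asboolT hk0)).
by case: (nk k); split=> // j /asboolT/kmin.
Qed.

Lemma wide_order_neq0 f : additive_fun f -> is_wide_hder f -> (exists x, f x <> 0) ->
  exists y, iter (wide_order f) (ad y) f 1 != 0.
Proof.
move=> fD /wide_orderP[hf fmin] [x fx]; apply: contrapT => nf.
have f0 y : iter (wide_order f) (ad y) f 1 = 0.
  by apply/eqP/negPn/negP => fy; apply: nf; exists y.
case E : (wide_order f) f0 fmin hf => [|k] f0 fmin hf.
  by apply: fx; rewrite (wide_hder0 hf) (f0 x : f 1 = 0) mul0r.
by have := fmin k (wide_hder_pred fD hf f0); rewrite ltnn.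
Qed.

(** Points are merged one at a time: on the line from [y] ([s = 0]) to [z] ([s = 1]) each condition
    is a nonzero polynomial in [s], and their product is nonzero at some natural number. *)
Lemma common_neq0 (I : finType) (h : I -> F -> C) (m : I -> nat) :
  (forall i, additive_fun (h i)) ->
  (forall i, exists y, iter (m i) (ad y) (h i) 1 != 0) ->
  exists y, forall i, iter (m i) (ad y) (h i) 1 != 0.
Proof.
move=> hD h_neq0.
suff [y hy] : exists y, forall i, i \in enum I -> iter (m i) (ad y) (h i) 1 != 0.
  by exists y => i; apply: hy; rewrite mem_enum.
elim: (enum I) => [|i r [y hy]]; first by exists 0.
have [z hz] := h_neq0 i.
have /choice[P PE] : forall j, exists Q : {poly C}, forall s : nat,
    iter (m j) (ad (y + s%:R * (z - y))) (h j) 1 = Q.[s%:R].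
  move=> j; have [Q [QE _ _]] := iter_ad_line y (z - y) (m j) (hD j).
  by exists (Q 1).
have P_neq0 j : j \in i :: r -> P j != 0.
  rewrite inE => /predU1P[->|jr]; apply/eqP => P0.
    have := PE i 1; rewrite P0 horner0 mul1r addrC subrK => /eqP.
    by rewrite (negPf hz).
  by have := PE j 0; rewrite P0 horner0 mul0r addr0 => /eqP; rewrite (negPf (hy j jr)).
have : \prod_(j <- i :: r) P j != 0.
  by rewrite prodf_seq_neq0; apply/allP => j /P_neq0.
have [[s Ps] _|Ps0] := pselect (exists s : nat, (\prod_(j <- i :: r) P j).[s%:R] != 0).
  exists (y + s%:R * (z - y)) => j jr; rewrite PE; apply: contra Ps => /eqP Pj.
  by rewrite horner_prod prodf_seq_eq0; apply/hasP; exists j; rewrite ?Pj ?eqxx.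
case/eqP; apply: poly_natr_eq0 => s; apply/eqP/negPn/negP => Ps.
by apply: Ps0; exists s.
Qed.

(** Replacing [x] by [x y] acts on [f] as [ad y] plus multiplication by [y], which on the
    coefficients of [h] is multiplication by [T + y]. *)
Lemma jet_ad_mulX K f x y h : (forall z, iter K.+1 (ad y) f z = 0) ->
  jet K (fun j => iter j (ad y) f x) (h * ('X + (\val y)%:P)) =
  jet K (fun j => iter j (ad y) f (x * y)) h.
Proof.
move=> fK; rewrite mulrDr jetD mulrC [_ * _%:P]mulrC mul_polyC jetZ /jet.
rewrite [X in X + _ = _]big_ord_recl [in RHS](eq_bigr (fun j : 'I_K.+1 =>
  iter j.+1 (ad y) f x * h`_j + \val y * (iter j (ad y) f x * h`_j))) => [|j _].
  rewrite big_split -mulr_sumr /= coefXM mulr0 add0r; congr (_ + _).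
  rewrite [RHS]big_ord_recr /= -[ad y _ x]/(iter K.+1 (ad y) f x) fK mul0r addr0.
  by apply: eq_bigr => j _; rewrite coefXM.
rewrite (_ : iter j.+1 (ad y) f x =
  iter j (ad y) f (x * y) - \val y * iter j (ad y) f x) //; ring.
Qed.

Lemma jet_ad K f x y (a : {poly int}) : additive_fun f ->
  (forall z, iter K.+1 (ad y) f z = 0) ->
  f (x * (map_poly intr a).[y]) =
  jet K (fun j => iter j (ad y) f x) (map_poly intr a \Po ('X + (\val y)%:P)).
Proof.
move=> fD fK; elim/poly_ind: a x => [|a c IH] x.
  by rewrite !rmorph0 horner0 mulr0 additive_fun0 // /jet big1 // => j _;
    rewrite coef0 mulr0.
rewrite !rmorphD !rmorphM /= !map_polyX !map_polyC /= hornerMXaddC.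
rewrite comp_polyX comp_polyC jetD jet_ad_mulX // -IH.
rewrite -[c%:~R%:P]mulr1 mul_polyC jetZ jet1 /= -additive_funMz // -fD.
by congr f; ring.
Qed.

Lemma derivation_ad f : additive_fun f -> wide_hder 1 f ->
  derivation (fun y => ad y f 1).
Proof.
move=> fD hf; split=> x y; rewrite /ad !mul1r; first by rewrite fD rmorphD; ring.
have := wide_hder0 (wide_hder_ad y hf) x; rewrite /ad mul1r => /eqP.
by rewrite subr_eq => /eqP ->; rewrite rmorphM; ring.
Qed.

Lemma ad1E f x : f x = ad x f 1 + f 1 * \val x.
Proof. by rewrite /ad mul1r; ring. Qed.

(** Restricted to a line [y + s z], the three functions are affine in [s], and a root of [al] or
    [be] is a root of [de]; affine functions with a common root are proportional. *)
Lemma proportional_factors (al be de : F -> C) (c e : C) (m : nat) z :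
  additive_fun al -> additive_fun be -> additive_fun de ->
  c != 0 -> e != 0 -> (0 < m)%N -> de z != 0 ->
  (forall y, c * al y * be y ^+ m + e * de y ^+ m.+1 = 0) ->
  [/\ al z != 0, be z != 0 &
      forall y, al y = al z / de z * de y /\ be y = be z / de z * de y].
Proof.
move=> alD beD deD c0 e0 m0 dz E.
have /andP[az bz] : (al z != 0) && (be z != 0).
  have /eqP := E z; rewrite addr_eq0 => /eqP Ez.
  have : c * al z * be z ^+ m != 0 by rewrite Ez oppr_eq0 mulf_neq0 ?expf_neq0.
  by rewrite !mulf_eq0 expf_eq0 m0 !negb_or (negPf c0).
split=> // y.
pose line (h : F -> C) s := h y + s * h z.
have lineE h (s : nat) : additive_fun h -> line h s%:R = h (y + s%:R * z).
  by move=> hD; rewrite hD additive_funMn.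
have line_pol h : polyfun (line h).
  exact: (polyfunD (polyfun_cst (h y)) (polyfunM (@polyfun_id _) (polyfun_cst (h z)))).
have Es s : c * line al s * line be s ^+ m + e * line de s ^+ m.+1 = 0.
  apply: (@polyfun_eq0 _ (fun s => c * line al s * line be s ^+ m
                                + e * line de s ^+ m.+1)); last first.
    by move=> {}s; rewrite !lineE // E.
  exact: (polyfunD (polyfunM (polyfunM (polyfun_cst c) (line_pol al))
    (polyfunX m (line_pol be)))
    (polyfunM (polyfun_cst e) (polyfunX m.+1 (line_pol de)))).
(* The root of [line h] is [- (h y / h z)]; that [line de] vanishes there is the claimed
   proportionality. *)
have root h : h z != 0 -> (line h (- (h y / h z)) = 0 ->
    line de (- (h y / h z)) = 0) -> h y = h z / de z * de y.
  move=> hz; rewrite /line mulNr divfK // subrr => /(_ erefl)/eqP.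
  by rewrite mulNr subr_eq0 => /eqP ->; field; rewrite hz dz.
have de0 s : line al s * line be s ^+ m = 0 -> line de s = 0.
  move=> ab0; have /eqP := Es s; rewrite -mulrA ab0 mulr0 add0r.
  by rewrite mulf_eq0 (negPf e0) expf_eq0 /= => /eqP.
split; apply: root => // h0; apply: de0; first by rewrite h0 mul0r.
by rewrite h0 expr0n (gtn_eqF m0) mulr0.
Qed.

End DifferentialOperators.

(** * From the jet identity to the two alternatives *)

Theorem theorem7 (R : realType) (A : pred R[i]) (F : subFieldType A)
    (n N : nat) (p q : 'I_n -> nat) (f g : 'I_n -> F -> R[i]) (K : nat)
    (n_gt0 : (0 < n)%N) (N_gt0 : (0 < N)%N)
    (p_gt0 : forall i, (0 < p i)%N) (q_gt0 : forall i, (0 < q i)%N)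
    (p_incr : forall i j : 'I_n, (i < j)%N -> (p i < p j)%N)
    (pqN : forall i, (p i + q i)%N = N)
    (p_neq_q : forall i j, i != j -> p i <> q j)
    (f_add : forall i, additive_fun (f i))
    (g_add : forall i, additive_fun (g i))
    (f_neq0 : forall i, exists x, f i x <> 0)
    (g_neq0 : forall i, exists x, g i x <> 0)
    (f_hder : forall i, is_wide_hder (f i))
    (g_hder : forall i, is_wide_hder (g i))
    (eq0 : forall x : F, \sum_(i < n) f i (x ^+ p i) * g i x ^+ q i = 0)
    (defK : K = \max_(i < n) maxn (wide_order (f i)) (wide_order (g i))) :
  (exists (i : 'I_n) (c : R[i]),
      (forall x, g i x = c * \val x) /\ wide_order (f i) = K)
  \/
  ((forall i, (wide_order (f i) <= 1)%N /\ (wide_order (g i) <= 1)%N) /\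
   exists i1 i2 : 'I_n,
     [/\ i1 != i2, q i2 = (q i1 + 1)%N, p i2 = (p i1 - 1)%N &
      exists (d : F -> R[i]) (l11 l10 m11 m10 l20 m21 m20 : R[i]),
        [/\ derivation d,
            forall x, f i1 x = l11 * d x + l10 * \val x,
            forall x, g i1 x = m11 * d x + m10 * \val x,
            forall x, f i2 x = l20 * \val x &
            forall x, g i2 x = m21 * d x + m20 * \val x] /\
        [/\ l11 <> 0, m11 <> 0, l20 <> 0, m21 <> 0 &
            (p i1)%:R * l11 * m11 ^+ q i1 + l20 * m21 ^+ (q i1 + 1) = 0]]).
Proof.
pose k i := wide_order (f i); pose l i := wide_order (g i).
have k_le i : (k i <= K)%N.
  by rewrite defK; apply: leq_trans (leq_maxl _ _) (leq_bigmax i).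
have l_le i : (l i <= K)%N.
  by rewrite defK; apply: leq_trans (leq_maxr _ _) (leq_bigmax i).
have fP i := wide_orderP (f_hder i); have gP i := wide_orderP (g_hder i).
have q_inj : injective q.
  move=> i j qij; have := pqN i; rewrite -(pqN j) qij => /addIn pij.
  by case: (ltngtP i j) => [/p_incr|/p_incr|/ord_inj//]; rewrite pij ltnn.
have [[i [kiK li0]]|notA] := pselect (exists i, k i = K /\ l i = 0%N).
  left; exists i, (g i 1); split=> //.
  by apply: wide_hder0; have [] := gP i; rewrite -/(l i) li0.
have l_neq0 i : k i = K -> l i != 0%N.
  by move=> kiK; apply/eqP => li0; apply: notA; exists i.
have attained : exists i, k i = K \/ l i = K.
  have [|i Ki] := @bigop.eq_bigmax 'I_n (fun i => maxn (k i) (l i)).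
    by rewrite card_ord.
  exists i; rewrite defK [X in _ = X]Ki [X in _ \/ _ = X]Ki.
  by case/orP: (leq_total (k i) (l i)) => kl;
    [rewrite (maxn_idPr kl); right | rewrite (maxn_idPl kl); left].
(* For [K = 0] any index would satisfy alternative (A). *)
have K_gt0 : (0 < K)%N.
  rewrite lt0n; apply/eqP => K0; have := l_le (Ordinal n_gt0).
  have := k_le (Ordinal n_gt0); rewrite K0 !leqn0 => /eqP k0.
  by rewrite (negPf (l_neq0 _ _)) // k0 K0.
have fK i y z : iter K.+1 (ad y) (f i) z = 0.
  by have [hf _] := fP i; apply: (iter_ad_eq0 _ _ hf); rewrite ltnS k_le.
have gK i y z : iter K.+1 (ad y) (g i) z = 0.
  by have [hg _] := gP i; apply: (iter_ad_eq0 _ _ hg); rewrite ltnS l_le.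
pose phi y i j := iter j (ad y) (f i) 1; pose gam y i j := iter j (ad y) (g i) 1.
(* For integer [a], the identity at [h = a(T + y)] is the given equation at [x = a(y)]; density
   extends it to all [h]. *)
have jet_eq0 y h : \sum_i jet K (phi y i) (h ^+ p i) * jet K (gam y i) h ^+ q i = 0.
  move: h; apply: (@poly_density _
    (fun h => \sum_i jet K (phi y i) (h ^+ p i) * jet K (gam y i) h ^+ q i) (\val y)).
    move=> u v; apply: polyfun_sum => i.
    have jet_pol a m : polyfun (fun s => jet K a ((u + s *: v) ^+ m)).
      apply: polyfun_sum => j.
      exact: (polyfunM (polyfun_cst (a j)) (polyfun_coef_exp u v m j)).
    exact: (polyfunM (jet_pol _ _) (polyfunX _ (jet_pol _ 1%N))).
  move=> a; rewrite -[RHS](eq0 (map_poly intr a).[y]); apply: eq_bigr => i _.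
  have jetE h m : additive_fun h -> (forall z, iter K.+1 (ad y) h z = 0) ->
      jet K (fun j => iter j (ad y) h 1) ((map_poly intr a \Po ('X + (\val y)%:P)) ^+ m)
      = h ((map_poly intr a).[y] ^+ m).
    move=> hD hK.
    have -> : (map_poly intr a).[y] ^+ m = (map_poly intr (a ^+ m)).[y].
      by rewrite rmorphXn horner_exp.
    have -> : (map_poly intr a \Po ('X + (\val y)%:P)) ^+ m =
        map_poly intr (a ^+ m) \Po ('X + (\val y)%:P) by rewrite !rmorphXn.
    by rewrite -jet_ad // mul1r.
  by rewrite jetE //; congr (_ * _ ^+ _); have := jetE (g i) 1%N; rewrite !expr1 => ->.
(* One family for all [f i] and [g i], so that a single [y] detects all the orders. *)
pose fg (i : 'I_n * bool) : F -> R[i] := if i.2 then f i.1 else g i.1.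
have [y hy] : exists y, forall i, iter (wide_order (fg i)) (ad y) (fg i) 1 != 0.
  by apply: common_neq0 => -[i []]; rewrite /fg //=; apply: wide_order_neq0.
have phi_gt z i j : (k i < j)%N -> phi z i j = 0.
  by have [hf _] := fP i; apply: iter_ad_eq0 hf.
have gam_gt z i j : (l i < j)%N -> gam z i j = 0.
  by have [hg _] := gP i; apply: iter_ad_eq0 hg.
have [K1 [a [b [la q_max ka [kb lb] qab]]]] := jet_dichotomy p_gt0 q_gt0 pqN
  q_inj K_gt0 k_le l_le (fun i => hy (i, true)) (fun i => hy (i, false))
  (phi_gt y) (gam_gt y) attained l_neq0 (jet_eq0 y).
(* The indices [a] and [b] are characterized by orders and exponents alone, so the top coefficient
   can be read at every [z], not only at [y]. *)
have E z : (p b)%:R * ad z (f b) 1 * ad z (g b) 1 ^+ q b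
         + f a 1 * ad z (g a) 1 ^+ (q b).+1 = 0.
  have phi_K i j : (K < j)%N -> phi z i j = 0 by move/(leq_ltn_trans (k_le i))/phi_gt.
  have gam_K i j : (K < j)%N -> gam z i j = 0 by move/(leq_ltn_trans (l_le i))/gam_gt.
  have q_max' i : gam z i K != 0 -> (q i <= q a)%N.
    move=> gi; apply/q_max/eqP; rewrite eqn_leq l_le leqNgt.
    by apply: contra gi => /gam_gt->.
  have := jet_top_coef K_gt0 phi_K gam_K (jet_eq0 z) q_inj (q_gt0 b) qab _ q_max'.
  by rewrite K1; apply; apply: phi_gt; rewrite ka.
have hder1 (h : F -> R[i]) : is_wide_hder h -> wide_order h = K -> wide_hder 1 h.
  by move=> /wide_orderP[hh _] hK; rewrite -K1 -hK.
have d_der := derivation_ad (g_add a) (hder1 _ (g_hder a) la).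
have [z dz] : exists z, ad z (g a) 1 != 0.
  by have := wide_order_neq0 (g_add a) (g_hder a) (g_neq0 a); rewrite -/(l a) la K1.
have fa_val : forall x, f a x = f a 1 * \val x.
  by apply: wide_hder0; have [] := fP a; rewrite -/(k a) ka.
have fa_neq0 : f a 1 != 0.
  by have := hy (a, true); rewrite /= -/(k a) ka.
have [|fz gz prop] := @proportional_factors _ _ _ (fun x => ad x (f b) 1)
  (fun x => ad x (g b) 1) (fun x => ad x (g a) 1) (p b)%:R (f a 1) (q b) z
  (derivation_ad (f_add b) (hder1 _ (f_hder b) kb)).1
  (derivation_ad (g_add b) (hder1 _ (g_hder b) lb)).1 d_der.1 _ fa_neq0 (q_gt0 b)
  dz E; first by rewrite pnatr_eq0 -lt0n.
right; split; first by move=> i; rewrite -K1; split; [apply: k_le | apply: l_le].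
exists b, a; split; [by apply/eqP => ba; move: qab; rewrite ba; lia |
  by rewrite addn1 | by have := pqN a; have := pqN b; lia |].
(* The derivation is that of [g a], whose coefficient is therefore 1; the other two coefficients are
   the ratios at [z]. *)
exists (fun x => ad x (g a) 1), (ad z (f b) 1 / ad z (g a) 1), (f b 1),
  (ad z (g b) 1 / ad z (g a) 1), (g b 1), (f a 1), 1, (g a 1).
split; split=> //.
- by move=> x; rewrite {1}(ad1E (f b)) (prop x).1.
- by move=> x; rewrite {1}(ad1E (g b)) (prop x).2.
- by move=> x; rewrite mul1r; apply: ad1E.
- by apply/eqP; rewrite mulf_neq0 ?invr_neq0.
- by apply/eqP; rewrite mulf_neq0 ?invr_neq0.
- exact/eqP.
- exact/eqP/oner_neq0.
(* After multiplication by the power [q b + 1] of [ad z (g a) 1], the relation between the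
   coefficients is [E z]. *)
apply: (mulIf (expf_neq0 (q b).+1 dz)); rewrite mul0r -[RHS](E z) addn1 expr1n.
by rewrite expr_div_n exprS; field; rewrite dz expf_neq0.
Qed.
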